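(* Let $D$ be a semi-regular $(k,n,k,\lambda)$-relative difference set in an abelian group $G$. Then there are $n+1$ mutually unbiased bases in $\mathbb{C}^k$.
   Context: A subset $D$ of a finite group $G$ is an $(m,n,k,\lambda)$-relative difference set if there is a normal subgroup $N$ of $G$ (the excluded subgroup) with $|N|=n$, $|G|=mn$, $|D|=k$ such that every element of $G\setminus N$ can be written as $gh^{-1}$ with $(g,h)\in D\times D$ in exactly $\lambda$ ways, and no non-identity element of $N$ can be so written. It is semi-regular if $m=k$ (in which case $k=\lambda n$). A collection of bases of $\mathbb{C}^k$ is mutually unbiased if each basis is orthonormal and there is a constant $\alpha$ such that $|u^*v|^2=\alpha$ whenever $u$ and $v$ belong to different bases of the collection. *)

(* Defs.v *)
From mathcomp Require Import all_boot all_order all_fingroup all_algebra.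
From mathcomp Require Import finmap.
From mathcomp Require Import reals complex.

Set Implicit Arguments.
Unset Strict Implicit.
Unset Printing Implicit Defensive.

Import GRing.Theory Num.Theory.

Section RelativeDifferenceSet.
Variable gT : finGroupType.
Local Open Scope group_scope.

Definition num_quotients (D : {set gT}) (x : gT) : nat :=
  #|[set gh in setX D D | gh.1 * gh.2^-1 == x]|.

Definition rel_diff_set_wrt (G N : {group gT}) (D : {set gT})
    (m n k lambda : nat) : Prop :=
  [/\ N <| G, D \subset G &
   [/\ #|N| = n, #|G| = (m * n)%N, #|D| = k,
       {in G :\: N, forall x, num_quotients D x = lambda} &
       {in N^#, forall x,
          ~ exists g h, [/\ g \in D, h \in D & x = g * h^-1]}]].

Definition rel_diff_set (G : {group gT}) (D : {set gT})
    (m n k lambda : nat) : Prop :=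
  exists N : {group gT}, rel_diff_set_wrt G N D m n k lambda.

(* The relation k = lambda * n is not part of the definition: it follows by
   counting when k > 1, and it can fail for k = 1 (where G = N and lambda is
   unconstrained). *)
Definition semiregular_rel_diff_set (G : {group gT}) (D : {set gT})
    (m n k lambda : nat) : Prop :=
  rel_diff_set G D m n k lambda /\ m = k.

End RelativeDifferenceSet.

Section MutuallyUnbiasedBases.
Variables (C : numClosedFieldType) (k : nat).
Local Open Scope ring_scope.
Local Open Scope fset_scope.
Local Open Scope sesquilinear_scope.

Definition cdot (u v : 'cV[C]_k) : C := (u ^t* *m v) 0 0.

Definition orthonormal_basis (B : {fset 'cV[C]_k}) : Prop :=
  basis_of fullv B /\ {in B &, forall u v, cdot u v = (u == v)%:R}.

(* Bases are unordered and a collection is a set of bases, so that distinct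
   members of a collection differ as sets of vectors. *)
Definition mutually_unbiased (Bs : {fset {fset 'cV[C]_k}}) : Prop :=
  {in Bs, forall B, orthonormal_basis B} /\
  exists alpha : C, forall B1 B2 : {fset 'cV[C]_k},
    B1 \in Bs -> B2 \in Bs -> B1 != B2 ->
    forall u v, u \in B1 -> v \in B2 -> `|cdot u v| ^+ 2 = alpha.

End MutuallyUnbiasedBases.

(* Main.v *)
Require Import Defs.
From mathcomp Require Import all_boot all_order all_fingroup all_algebra.
From mathcomp Require Import all_solvable all_field all_character.
From mathcomp Require Import finmap.
From mathcomp Require Import reals complex.

Set Implicit Arguments.
Unset Strict Implicit.
Unset Printing Implicit Defensive.

Import Order.TTheory GRing.Theory Num.Theory GroupScope.

(** For a character [phi] of [G] put [v_phi = (phi(d) / sqrt k)_{d in D}]. The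
    inner product of [v_phi] and [v_psi] is [chi(D) / k] with
    [chi = conj(phi) psi]. If [chi] is trivial on [N] but not on [G], then
    [chi(D) = 0], because [D] is a transversal of [N]. If [chi] is nontrivial on
    [N], then [|chi(D)|^2 = k + lambda (chi(G) - chi(N)) = k]. Hence the [k n]
    vectors [v_phi], grouped by the restriction of [phi] to [N], fall into at
    most [n] orthonormal families of size at most [k], so into exactly [n]
    orthonormal bases, unbiased to each other and to the standard basis with
    constant [1 / k]. *)

(** * Roots of unity and linear characters with values in a closed field *)

Section CharacterValues.
Variable C : numClosedFieldType.
Local Open Scope ring_scope.

(** In characteristic 0 the polynomial ['X^n - 1] is separable, so it has [n] distinct roots in [C],
    and [n] distinct [n]-th roots of unity always include a primitive one. *)
Lemma closed_prim_root_exists n :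
  (0 < n)%N -> exists z : C, n.-primitive_root z.
Proof.
move=> n_gt0; pose p : {poly C} := 'X^n - 1.
have [r Dp] := closed_field_poly_normal p.
rewrite (monicP _) ?monicXnsubC // scale1r in Dp.
have rn1: all n.-unity_root r by apply/allP=> z; rewrite -root_prod_XsubC -Dp.
have sz_r: (n < (size r).+1)%N.
  by rewrite -(size_prod_XsubC r id) -Dp size_XnsubC.
have [|z _ zP] := hasP (has_prim_root n_gt0 rn1 _ sz_r); last by exists z.
by rewrite -separable_prod_XsubC -Dp separable_Xn_sub_1 // pnatr_eq0 -lt0n.
Qed.

(* MathComp characters take values in [algC]; this transports them to [C]. *)
Lemma unity_root_embedding n : (0 < n)%N ->
  exists f : algC -> C,
    [/\ f 1 = 1,
        {in n.-unity_root &, {morph f : x y / x * y}} &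
        {in n.-unity_root &, injective f}].
Proof.
move=> n_gt0; have [z zP] := C_prim_root_exists n_gt0.
have [w wP] := closed_prim_root_exists n_gt0.
(* [f] sends [z ^+ i] to [w ^+ i]; the default value 0 is taken only off the [n]-th roots of
   unity. *)
pose f x := if [pick i : 'I_n | x == z ^+ i] is Some i then w ^+ i else 0.
have fE i : f (z ^+ i) = w ^+ i.
  rewrite /f; case: pickP => [j|no_i].
    by rewrite (eq_prim_root_expr zP) -(eq_prim_root_expr wP) => /eqP.
  have /(prim_rootP zP)[j Dj] : z ^+ i ^+ n = 1.
    by rewrite exprAC (prim_expr_order zP) expr1n.
  by have:= no_i j; rewrite Dj eqxx.
exists f; split=> [|x y|x y].
- by rewrite -(expr0 z) fE.
- move=> /unity_rootP /(prim_rootP zP)[i ->] /unity_rootP /(prim_rootP zP)[j ->].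
  by rewrite -exprD !fE exprD.
move=> /unity_rootP /(prim_rootP zP)[i ->] /unity_rootP /(prim_rootP zP)[j ->].
rewrite !fE => /eqP.
by rewrite (eq_prim_root_expr wP) -(eq_prim_root_expr zP) => /eqP.
Qed.

(** [X] lists the characters of [G], all linear since [G] is abelian, and [r] is restriction to [N].
    Their values are [#|G|]-th roots of unity, where the transport to [C] is multiplicative and
    injective, so no equality between characters is created or lost. *)
Lemma dual_group_restriction (gT : finGroupType) (G N : {group gT}) :
  abelian G -> N \subset G ->
  exists (X : Iirr G -> gT -> C) (r : Iirr G -> Iirr N),
    [/\ forall i, X i 1%g = 1,
        forall i, {in G &, {morph X i : x y / (x * y)%g >-> x * y}},
        forall i j, {in G, X i =1 X j} -> i = j &
        forall i j, {in N, X i =1 X j} <-> r i = r j].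
Proof.
move=> abG sNG; have [f [f1 fM f_inj]] := unity_root_embedding (cardG_gt0 G).
have lin (i : Iirr G) := char_abelianP _ abG i.
have chiU i x : x \in G -> 'chi[G]_i x \in #|G|.-unity_root.
  by move=> Gx; apply/unity_rootP; rewrite -lin_charX ?lin // expg_cardG ?lin_char1 ?lin.
exists (fun i x => f ('chi_i x)), (Res_Iirr N).
have eqX (i j : Iirr G) (A : {set gT}) : A \subset G ->
    {in A, (fun x => f ('chi[G]_i x)) =1 (fun x => f ('chi_j x))} <->
    {in A, 'chi_i =1 'chi_j}.
  move=> sAG; split=> eq_ij x Ax; last by rewrite /= eq_ij.
  have Gx := subsetP sAG x Ax.
  by apply: f_inj; [exact: chiU | exact: chiU | exact: eq_ij].
split=> [i|i x y Gx Gy|i j|i j].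
- by rewrite lin_char1 ?lin.
- by rewrite lin_charM ?lin // fM ?chiU.
- move=> /(eqX _ _ _ (subxx _)) eq_ij; apply: irr_inj; apply/cfun_inP => x Gx.
  exact: eq_ij.
have ResE l : 'chi_(Res_Iirr N l) = 'Res[N] 'chi[G]_l.
  by rewrite lin_Res_IirrE ?lin_char1 ?lin.
split=> [/(eqX _ _ _ sNG) eq_ij | eq_r].
  apply: irr_inj; rewrite !ResE; apply/cfun_inP => x Nx.
  by rewrite !cfResE // eq_ij.
apply/(eqX _ _ _ sNG) => x Nx.
by rewrite -!(cfResE _ sNG Nx) -!ResE eq_r.
Qed.

End CharacterValues.

(** * Sums of a linear character over a group and over a relative difference set *)

Section CharacterSums.
Variables (C : numClosedFieldType) (gT : finGroupType) (G : {group gT}).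
Variable phi : gT -> C.
Local Open Scope ring_scope.
Hypothesis phi1 : phi 1%g = 1.
Hypothesis phiM : {in G &, {morph phi : x y / (x * y)%g >-> x * y}}.

Lemma norm_char x : x \in G -> `|phi x| = 1.
Proof.
move=> Gx; apply/eqP; rewrite -(@pexpr_eq1 _ _ #|G|) // -normrX.
suffices phiX m : phi (x ^+ m)%g = phi x ^+ m.
  by rewrite -phiX expg_cardG // phi1 normr1.
elim: m => [|m IHm]; first by rewrite expg0.
by rewrite expgS phiM ?groupX // IHm exprS.
Qed.

Lemma mul_conj_char x : x \in G -> (phi x)^* * phi x = 1.
Proof. by move=> Gx; rewrite mulrC -normCK norm_char ?expr1n. Qed.

Lemma conj_char x : x \in G -> (phi x)^* = phi x^-1%g.
Proof.
move=> Gx; rewrite -[LHS]mulr1 -phi1 -(mulgV x) phiM ?groupV //.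
by rewrite mulrA mul_conj_char ?mul1r.
Qed.

(** Translation by [x] permutes [H] and multiplies the sum by [phi x], which differs from 1. *)
Lemma sum_nontrivial_char (H : {group gT}) x :
  H \subset G -> x \in H -> phi x != 1 -> \sum_(y in H) phi y = 0.
Proof.
move=> sHG Hx phix1; apply: contraNeq phix1 => s0.
rewrite -(inj_eq (mulIf s0)) mul1r mulr_sumr; apply/eqP.
rewrite [RHS](reindex_inj (mulgI x)) /=.
by apply: eq_big => [y | y Hy]; rewrite ?groupMl // phiM // (subsetP sHG).
Qed.

Variables (N : {group gT}) (D : {set gT}).
Hypotheses (sNG : N \subset G) (sDG : D \subset G).

(** [D] meets every coset of [N] exactly once and [phi] is constant on these cosets, so the
    vanishing sum over [G] is [#|N|] times the sum over [D]. *)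
Lemma sum_char_transversal x :
  #|G| = (#|D| * #|N|)%N ->
  {in D &, forall g h, (g * h^-1)%g \in N -> g = h} ->
  x \in G -> phi x != 1 -> {in N, forall y, phi y = 1} ->
  \sum_(g in D) phi g = 0.
Proof.
move=> oG trD Gx phix1 phiN1.
(* The product map from [D * N] to [G] is injective because distinct elements of [D] lie in distinct
   cosets, hence bijective by counting. *)
pose mu (p : gT * gT) := (p.2 * p.1)%g.
have mu_inj : {in setX D N &, injective mu}.
  move=> [g y] [h z] /setXP[/= Dg Ny] /setXP[/= Dh Nz]; rewrite /mu /= => eq_mu.
  have gh: g = h.
    apply: trD => //; have -> : (g * h^-1 = y^-1 * z)%g; last by rewrite groupM ?groupV.
    by apply: (mulgI y); rewrite mulgA eq_mu mulgK mulKVg.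
  by move: eq_mu; rewrite gh => /mulIg ->.
have muG : mu @: setX D N = G.
  apply/eqP; rewrite eqEcard card_in_imset // cardsX oG leqnn andbT.
  apply/subsetP=> _ /imsetP[[g y] /setXP[/= Dg Ny] ->].
  by rewrite groupM ?(subsetP sNG y) ?(subsetP sDG g).
have := sum_nontrivial_char (subxx G) Gx phix1.
rewrite -{1}muG big_imset //=.
rewrite (eq_bigr (fun p => phi p.1)) => [|[g y] /setXP[/= Dg Ny]]; last first.
  by rewrite /mu phiM ?(subsetP sNG y) ?(subsetP sDG g) // phiN1 ?mul1r.
rewrite (eq_bigl (fun p => (p.1 \in D) && (p.2 \in N))) => [|p]; last by rewrite inE.
rewrite -(pair_big (mem D) (mem N) (fun g _ => phi g)) /=.
under eq_bigr do rewrite sumr_const.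
rewrite sumrMnl => /eqP; rewrite -mulr_natr mulf_eq0 pnatr_eq0.
by rewrite -[_ == 0%N]negbK -lt0n cardG_gt0 orbF => /eqP.
Qed.

(** Since conjugation inverts the values of [phi], the squared modulus is the sum of
    [phi (g * h^-1)] over pairs in [D]; the pairs are then grouped by their quotient. *)
Lemma sum_char_num_quotients :
  `|\sum_(g in D) phi g| ^+ 2 = \sum_(x in G) (num_quotients D x)%:R * phi x.
Proof.
rewrite normCK rmorph_sum big_distrlr /= pair_big /=.
rewrite (partition_big (fun p => p.1 * p.2^-1)%g (mem G)) /= => [|p /andP[Dp Dq]]; last first.
  by rewrite groupM ?groupV ?(subsetP sDG).
apply: eq_bigr => x Gx.
rewrite (eq_bigr (fun=> phi x)) => [|p /andP[/andP[Dp Dq] /eqP <-]]; last first.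
  by rewrite conj_char ?phiM ?groupV ?(subsetP sDG).
rewrite sumr_const mulr_natl; congr (_ *+ _); rewrite /num_quotients.
by apply: eq_card => p; rewrite !inE.
Qed.

(** The identity contributes [k], from the diagonal pairs, and the rest of [N] contributes 0.
    Outside [N] the contribution is [lambda] times the difference of the sums of [phi] over [G] and
    over [N], both zero. *)
Lemma sqr_norm_sum_char_rel_diff_set m n k lambda y :
  rel_diff_set_wrt G N D m n k lambda ->
  y \in N -> phi y != 1 -> `|\sum_(g in D) phi g| ^+ 2 = k%:R.
Proof.
case=> _ _ [_ _ oD nqG nqN] Ny phiy1; rewrite sum_char_num_quotients.
have nq1 : num_quotients D 1 = k.
  rewrite -oD /num_quotients -(card_imset D (f := fun g => (g, g))); last by move=> g h [].
  apply: eq_card => -[g h]; rewrite !inE /= -eq_mulgV1.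
  apply/andP/imsetP=> [[/andP[Dg _] /eqP <-]|[g' Dg' [-> ->]]]; first by exists g.
  by rewrite Dg' eqxx.
have nq0 : {in N^#, forall x, num_quotients D x = 0%N}.
  move=> x /nqN no_x; apply/eqP; rewrite cards_eq0; apply/eqP/setP=> -[g h].
  rewrite !inE /=; apply/negP=> /andP[/andP[Dg Dh] /eqP def_x].
  by apply: no_x; exists g, h; rewrite -def_x.
rewrite (big_setID N) /= (setIidPr sNG) (big_setD1 1%g) //= nq1 phi1 mulr1.
rewrite big1 ?addr0 => [|x /nq0 ->]; last by rewrite mul0r.
rewrite (eq_bigr (fun x => lambda%:R * phi x)) => [|x /nqG -> //].
have := sum_nontrivial_char (subxx G) (subsetP sNG y Ny) phiy1.
rewrite (big_setID N) /= (setIidPr sNG) (sum_nontrivial_char sNG Ny phiy1).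
by rewrite add0r -mulr_sumr => ->; rewrite mulr0 addr0.
Qed.

End CharacterSums.

(** * Orthonormal bases and unbiased families *)

Section UnbiasedBases.
Variables (C : numClosedFieldType) (k : nat).
Local Open Scope ring_scope.
Local Open Scope fset_scope.
Local Open Scope sesquilinear_scope.

Lemma cdotE (u v : 'cV[C]_k) : cdot u v = \sum_a (u a 0)^* * v a 0.
Proof. by rewrite /cdot mxE; apply: eq_bigr => a _; rewrite !mxE. Qed.

Lemma cdot_sumr (u : 'cV[C]_k) m (c : 'I_m -> C) (w : 'I_m -> 'cV[C]_k) :
  cdot u (\sum_i c i *: w i) = \sum_i c i * cdot u (w i).
Proof.
rewrite /cdot mulmx_sumr summxE; apply: eq_bigr => i _.
by rewrite -scalemxAr mxE.
Qed.

Lemma cdotC (u v : 'cV[C]_k) : cdot u v = (cdot v u)^*.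
Proof.
rewrite !cdotE rmorph_sum; apply: eq_bigr => a _.
by rewrite rmorphM /= conjCK mulrC.
Qed.

Lemma sqr_norm_cdotC (u v : 'cV[C]_k) : `|cdot u v| ^+ 2 = `|cdot v u| ^+ 2.
Proof. by rewrite cdotC norm_conjC. Qed.

Lemma orthonormal_free (B : {fset 'cV[C]_k}) :
  {in B &, forall u v, cdot u v = (u == v)%:R} -> free B.
Proof.
move=> oB; rewrite -(in_tupleE B); apply/freeP => c sum0 i.
have Bi (l : 'I_(size B)) : (in_tuple B)`_l \in B by apply: mem_nth.
have := cdot_sumr (in_tuple B)`_i c (fun l => (in_tuple B)`_l).
rewrite sum0 {1}/cdot mulmx0 mxE (bigD1 i) //= oB // eqxx mulr1 big1 => [|l ne_li].
  by rewrite addr0.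
by rewrite oB // nth_uniq ?fset_uniq // eq_sym (inj_eq val_inj) (negPf ne_li) mulr0.
Qed.

Lemma card_orthonormal (B : {fset 'cV[C]_k}) :
  {in B &, forall u v, cdot u v = (u == v)%:R} -> (#|` B| <= k)%N.
Proof.
move=> /orthonormal_free /eqnP <-.
by apply: leq_trans (dimvS (subvf _)) _; rewrite dimvf /dim /= muln1.
Qed.

Lemma orthonormal_basis_card (B : {fset 'cV[C]_k}) :
  {in B &, forall u v, cdot u v = (u == v)%:R} -> #|` B| = k ->
  orthonormal_basis B.
Proof.
move=> oB cardB; split=> //; rewrite basisEfree orthonormal_free // subvf /=.
rewrite dimvf /dim /= muln1; exact: eq_leq (esym cardB).
Qed.

Lemma mutually_unbiased_family (I : finType) (F : I -> {fset 'cV[C]_k}) alpha :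
  injective F -> (forall i, orthonormal_basis (F i)) ->
  (forall i j u v, i != j -> u \in F i -> v \in F j -> `|cdot u v| ^+ 2 = alpha) ->
  exists Bs : {fset {fset 'cV[C]_k}}, mutually_unbiased Bs /\ #|` Bs| = #|I|.
Proof.
move=> F_inj oF uF; exists [fset F i | i in I]; split; last first.
  by rewrite card_imfset //= cardE.
split=> [_ /imfsetP[i _ ->] //|]; exists alpha.
move=> _ _ /imfsetP[i _ ->] /imfsetP[j _ ->] ne_ij u v; apply: uF.
by apply: contraNneq ne_ij => ->.
Qed.

(** If two indices gave the same basis, a vector [u] of it would be unbiased to itself, and
    [cdot u u = 1] would force [alpha = 1]. Such a [u] exists because [k > 0]. *)
Lemma unbiased_family_inj (I : finType) (F : I -> {fset 'cV[C]_k}) alpha :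
  (0 < k)%N -> alpha != 1 -> (forall i, orthonormal_basis (F i)) ->
  (forall i j u v, i != j -> u \in F i -> v \in F j -> `|cdot u v| ^+ 2 = alpha) ->
  injective F.
Proof.
move=> k_gt0 alpha1 oF uF i j eqF; apply: contraNeq alpha1 => ne_ij.
have [u Fu] : exists u, u \in F i.
  apply/fset0Pn; apply: contraTneq k_gt0 => F0; have [/andP[+ _] _] := oF i.
  rewrite F0 => /eqP; rewrite span_nil => /(congr1 (fun U => \dim U)).
  by rewrite dimv0 dimvf /dim /= muln1 => <-.
rewrite -(uF i j u u) -?eqF //; have [_ ->] := oF i; rewrite //.
by rewrite eqxx normr1 expr1n.
Qed.

Definition standard_basis : {fset 'cV[C]_k} := [fset delta_mx a 0 | a in 'I_k].

Lemma cdot_delta (a : 'I_k) (v : 'cV[C]_k) : cdot (delta_mx a 0) v = v a 0.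
Proof.
rewrite cdotE (bigD1 a) //= big1 => [|b ne_ba]; rewrite !mxE.
  by rewrite !eqxx conjC1 mul1r addr0.
by rewrite (negPf ne_ba) conjC0 mul0r.
Qed.

Lemma delta_col_inj : injective (fun a : 'I_k => delta_mx a 0 : 'cV[C]_k).
Proof.
move=> a b /matrixP/(_ a 0)/eqP; rewrite !mxE !eqxx andbT eqr_nat.
by case: (a =P b).
Qed.

Lemma standard_basis_orthonormal : orthonormal_basis standard_basis.
Proof.
apply: orthonormal_basis_card; last first.
  by rewrite card_imfset /= -?cardE ?card_ord //; apply: delta_col_inj.
move=> _ _ /imfsetP[a _ ->] /imfsetP[b _ ->].
by rewrite cdot_delta mxE eqxx andbT (inj_eq delta_col_inj).
Qed.

End UnbiasedBases.

(** * Unbiased bases in dimension one *)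

Section DimensionOne.
Variable C : numClosedFieldType.
Local Open Scope ring_scope.

(** Every scalar of modulus 1 is an orthonormal basis by itself, and any two are unbiased with
    constant 1; the powers of a primitive [n]-th root of unity supply [n] distinct ones. *)
Lemma mutually_unbiased_dim1 n : (0 < n)%N ->
  exists Bs : {fset {fset 'cV[C]_1}}, mutually_unbiased Bs /\ #|` Bs| = n.
Proof.
move=> n_gt0; have [w wP] := closed_prim_root_exists C n_gt0.
pose F (i : 'I_n) : {fset 'cV[C]_1} := [fset const_mx (w ^+ i)]%fset.
have norm_w : `|w| = 1.
  apply/eqP; rewrite -(@pexpr_eq1 _ _ n) // -normrX.
  by rewrite (prim_expr_order wP) normr1.
have norm_cdot (i j : 'I_n) : `|cdot (const_mx (w ^+ i)) (const_mx (w ^+ j) : 'cV[C]_1)| = 1.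
  by rewrite cdotE big_ord1 !mxE normrM norm_conjC !normrX norm_w !expr1n mulr1.
rewrite -(card_ord n); apply: (mutually_unbiased_family (F := F) (alpha := 1)).
- move=> i j /fset1_inj /matrixP/(_ 0 0)/eqP; rewrite !mxE.
  by rewrite (eq_prim_root_expr wP) !modn_small // => /eqP/val_inj.
- move=> i; apply: orthonormal_basis_card; last by rewrite cardfs1.
  move=> _ _ /fset1P-> /fset1P->; rewrite eqxx cdotE big_ord1 !mxE mulrC -normCK.
  by rewrite normrX norm_w !expr1n.
- by move=> i j _ _ _ /fset1P-> /fset1P->; rewrite norm_cdot expr1n.
Qed.

End DimensionOne.

(** * The bases built from the characters, for [#|D| > 1] *)

Section RelativeDifferenceSetBases.
Variables (C : numClosedFieldType) (gT : finGroupType) (D : {set gT}).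
Local Open Scope ring_scope.

Definition char_vector (phi : gT -> C) : 'cV[C]_#|D| :=
  \col_a ((sqrtC #|D|%:R)^-1 * phi (enum_val a)).

Lemma cdot_char_vector phi psi :
  cdot (char_vector phi) (char_vector psi)
    = #|D|%:R^-1 * \sum_(x in D) (phi x)^* * psi x.
Proof.
have sqrt_ge0 : 0 <= sqrtC #|D|%:R :> C by rewrite sqrtC_ge0 ler0n.
rewrite cdotE [in RHS]big_enum_val mulr_sumr; apply: eq_bigr => a _; rewrite !mxE.
by rewrite rmorphM fmorphV /= (geC0_conj sqrt_ge0) mulrACA -invfM -expr2 sqrtCK.
Qed.

Variables (G N : {group gT}) (n lambda : nat).
Hypothesis abG : abelian G.
Hypothesis rdsD : rel_diff_set_wrt G N D #|D| n #|D| lambda.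

Lemma rel_diff_set_mutually_unbiased : (1 < #|D|)%N ->
  exists Bs : {fset {fset 'cV[C]_#|D|}}, mutually_unbiased Bs /\ #|` Bs| = n.+1.
Proof.
move=> D_gt1; have D_gt0 := ltnW D_gt1.
have [/andP[sNG _] sDG [oN oG _ _ nqN]] := rdsD.
have D_neq0 : #|D|%:R != 0 :> C by rewrite pnatr_eq0 -lt0n.
have trD : {in D &, forall g h, (g * h^-1)%g \in N -> g = h}.
  move=> g h Dg Dh Ngh; apply/eqP; rewrite eq_mulgV1; apply/negPn/negP=> gh1.
  by case: (nqN (g * h^-1)%g); rewrite ?inE ?gh1 //; exists g, h.
have [X [r [X1 XM X_inj rP]]] := dual_group_restriction C abG sNG.
(* This is again a linear character; its sum over [D], divided by [#|D|], is the inner product of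
   the vectors of [X i] and [X j]. *)
pose phi i j x := (X i x)^* * X j x.
have phi1 i j : phi i j 1%g = 1 by rewrite /phi !X1 conjC1 mul1r.
have phiM i j : {in G &, {morph phi i j : x y / (x * y)%g >-> x * y}}.
  by move=> x y Gx Gy; rewrite /phi !XM // rmorphM mulrACA.
have phi_eq1 i j x : x \in G -> (phi i j x == 1) = (X i x == X j x).
  move=> Gx; rewrite -(mul_conj_char (X1 i) (XM i) Gx) /phi eq_sym.
  apply/inj_eq/mulfI; rewrite conjC_eq0 -normr_eq0.
  by rewrite (norm_char (X1 i) (XM i)) ?oner_eq0.
pose v i := char_vector (X i).
have cdot_same i j : r i = r j -> cdot (v i) (v j) = (i == j)%:R.
  move=> eq_r; rewrite cdot_char_vector.
  case: eqVneq => [<-|ne_ij].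
    rewrite (eq_bigr (fun=> 1)) => [|x Dx]; last first.
      by rewrite (mul_conj_char (X1 i) (XM i)) ?(subsetP sDG).
    by rewrite sumr_const mulVf.
  have [x Gx ne_x] : exists2 x, x \in G & X i x != X j x.
    apply/exists_inP; rewrite -negb_forall_in; apply: contraNN ne_ij.
    by move=> /forall_inP eq_ij; apply/eqP/X_inj => x Gx; apply/eqP/eq_ij.
  rewrite (sum_char_transversal (phiM i j) sNG sDG (x := x)) ?mulr0 //.
  - by rewrite oN.
  - by rewrite phi_eq1.
  - move=> y Ny; apply/eqP; rewrite phi_eq1 ?(subsetP sNG) //.
    by apply/eqP; apply: (proj2 (rP i j) eq_r).
have cdot_diff i j : r i != r j -> `|cdot (v i) (v j)| ^+ 2 = #|D|%:R^-1.
  move=> ne_r; have [y Ny ne_y] : exists2 y, y \in N & X i y != X j y.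
    apply/exists_inP; rewrite -negb_forall_in; apply: contraNN ne_r.
    by move=> /forall_inP eq_ij; apply/eqP/rP => y Ny; apply/eqP/eq_ij.
  rewrite cdot_char_vector normrM exprMn normfV normr_nat.
  rewrite (sqr_norm_sum_char_rel_diff_set (phi1 i j) (phiM i j) sNG sDG rdsD Ny).
    by rewrite expr2 mulfVK.
  by rewrite phi_eq1 ?(subsetP sNG).
have v_inj i j : r i = r j -> v i = v j -> i = j.
  move=> eq_r eq_v; have := cdot_same i j eq_r; rewrite eq_v cdot_same // eqxx.
  by move/eqP; rewrite eqr_nat; case: (i =P j).
pose B t : {fset 'cV[C]_#|D|} := [fset v i | i in [set i | r i == t]]%fset.
have cardB t : #|` B t| = #|[set i | r i == t]|.
  rewrite card_in_imfset /= -?cardE // => i j; rewrite !inE => /eqP ri /eqP rj.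
  by apply: v_inj; rewrite ri rj.
have oB t : {in B t &, forall u w, cdot u w = (u == w)%:R}.
  move=> _ _ /imfsetP[i /= + ->] /imfsetP[j /= + ->].
  rewrite !inE => /eqP ri /eqP rj; rewrite cdot_same ?ri ?rj //; congr (_%:R).
  by congr nat_of_bool; apply/eqP/eqP => [-> //|/v_inj -> //]; rewrite ri rj.
have abN := abelianS sNG abG.
(* The [#|N|] blocks have at most [#|D|] vectors each, while their sizes add up to the number of
   characters, [#|G| = #|D| * #|N|]. So the bound is attained in every block. *)
have cardBD t : #|` B t| = #|D|.
  have le_B s : (#|` B s| <= #|D| ?= iff (#|` B s| == #|D|))%N.
    by split=> //; apply: card_orthonormal (oB s).
  have [_] := leqif_sum (fun s (_ : predT s) => le_B s).
  rewrite sum_nat_const card_Iirr_abelian // mulnC oN -oG -(card_Iirr_abelian abG).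
  rewrite -[X in _ == X]sum1_card [X in _ == X](partition_big r predT) //=.
  under eq_bigr do rewrite cardB -sum1dep_card.
  by rewrite eqxx => /esym/forallP/(_ t)/eqP.
(* [None] indexes the standard basis, which is the extra basis in [n.+1]. *)
pose F (o : option (Iirr N)) := oapp B (standard_basis C #|D|) o.
have onF o : orthonormal_basis (F o).
  case: o => [t|] /=; last exact: standard_basis_orthonormal.
  exact: orthonormal_basis_card (oB t) (cardBD t).
have cdot_std u w t : u \in standard_basis C #|D| -> w \in B t ->
    `|cdot u w| ^+ 2 = #|D|%:R^-1.
  move=> /imfsetP[a _ ->] /imfsetP[i _ ->]; rewrite cdot_delta mxE normrM.
  rewrite (norm_char (X1 i) (XM i)) ?(subsetP sDG) ?enum_valP // mulr1.
  by rewrite normfV ger0_norm ?sqrtC_ge0 ?ler0n // exprVn sqrtCK.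
have unbF o1 o2 u w : o1 != o2 -> u \in F o1 -> w \in F o2 ->
    `|cdot u w| ^+ 2 = #|D|%:R^-1.
  case: o1 o2 => [t1|] [t2|] //= ne_t.
  - move=> /imfsetP[i /= + ->] /imfsetP[j /= + ->].
    rewrite !inE => /eqP ri /eqP rj; apply: cdot_diff.
    by rewrite ri rj; apply: contraNneq ne_t => ->.
  - by rewrite sqr_norm_cdotC => Bu std_w; apply: cdot_std std_w Bu.
  - exact: cdot_std.
rewrite -oN -(card_Iirr_abelian abN) -card_option.
apply: (mutually_unbiased_family _ onF unbF).
(* The constant [1 / #|D|] differs from 1 because [#|D| > 1], so the bases are distinct. *)
apply: (unbiased_family_inj D_gt0 _ onF unbF).
by rewrite invr_eq1 pnatr_eq1 gtn_eqF.
Qed.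

End RelativeDifferenceSetBases.

(** * Combination of the cases [k > 1] and [k = 1] *)

Theorem lemma5p1p1 (R : realType) (gT : finGroupType) (G : {group gT})
    (D : {set gT}) (k n lambda : nat) :
  abelian G ->
  semiregular_rel_diff_set G D k n k lambda ->
  exists Bs : {fset {fset 'cV[complex R]_k}},
    mutually_unbiased Bs /\ #|` Bs| = n.+1.
Proof.
move=> abG [[N rdsD] _].
have [_ _ [_ oG oD _ _]] := rdsD; subst k.
have [D_gt1|] := ltnP 1 #|D|.
  exact: rel_diff_set_mutually_unbiased abG rdsD D_gt1.
(* For k = 1 the vectors v_phi are scalars of modulus 1 and may coincide. *)
have := cardG_gt0 G; rewrite oG muln_gt0 => /andP[D_gt0 _] D_le1.
have -> : #|D| = 1%N by apply/eqP; rewrite eqn_leq D_le1.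
exact: mutually_unbiased_dim1.
Qed.
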